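(* There exists a sequence of sets $A_n$, defined for all sufficiently large integers $n$, such that each $A_n$ is $n$-very-good and $$\lim_{n\to\infty}\dim_H(U_{A_n})=\frac{\log(2)}{\log(3)},$$ where $U_{A_n}$ is formed with respect to the base $n$.
   Context: For an integer $n\ge 2$ and a set $A$ of integers with $0,n-1\in A\subset\{0,1,\dots,n-1\}$, $C_A=C_{A,n}=\left\{\sum_{i=1}^\infty a_i n^{-i} : a_i\in A\right\}$, which is the attractor of the iterated function system $\{x\mapsto (x+a)/n : a\in A\}$. The sign $+$ between sets denotes the Minkowski sum. The set $A$ is called $n$-good if $0,n-1\in A\subset\{0,1,\dots,n-1\}$ and $C_A+C_A=[0,2]$. $U_A$ (the set of uniqueness) is the set of $z\in C_A+C_A$ for which there is exactly one ordered pair $(x,y)\in C_A\times C_A$ with $z=x+y$. $\dim_H$ denotes Hausdorff dimension. Adjacency matrix of an $n$-good set $A$: write $S_m(x)=(x+m)/n$ and $I_\ell=[\ell/n,(\ell+1)/n]$ for $\ell=0,1,\dots,2n-1$. The interval $I_\ell$ is of type $L$ if there is a unique ordered pair $(s,t)\in A\times A$ with $I_\ell=S_{s+t}([0,1])$ and, for all pairs $(s',t')\in A\times A$, $I_\ell\cap S_{s'+t'}((1,2))=\varnothing$. It is of type $R$ if there is a unique ordered pair $(s,t)\in A\times A$ with $I_\ell=S_{s+t}([1,2])$ and, for all pairs $(s',t')\in A\times A$, $I_\ell\cap S_{s'+t'}((0,1))=\varnothing$. The adjacency matrix is $M=\begin{bmatrix} a & b\\ c& d\end{bmatrix}$, where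 $a$ (respectively $b$) is the number of $\ell$ with $0\le \ell\le n-1$ such that $I_\ell$ is of type $L$ (respectively type $R$), and $c$ (respectively $d$) is the number of $\ell$ with $n\le\ell\le 2n-1$ such that $I_\ell$ is of type $L$ (respectively type $R$). The set $A$ is called $n$-very-good if (i) $A$ is $n$-good; (ii) $1\notin A$ and $n-2\notin A$; (iii) either $a+b=c+d$ or $a+c=b+d$, where $a,b,c,d$ are the entries of the adjacency matrix of $A$. *)

(* Defs.v *)
From HB Require Import structures.
From mathcomp Require Import all_boot all_order all_algebra.
From mathcomp Require Import all_classical all_reals all_analysis.

Set Implicit Arguments.
Unset Strict Implicit.
Unset Printing Implicit Defensive.

Import Order.TTheory GRing.Theory Num.Theory.
Import numFieldNormedType.Exports.

Local Open Scope classical_set_scope.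
Local Open Scope ring_scope.

Section HausdorffDimension.
Context {R : realType}.
Local Open Scope ereal_scope.

Definition diam (U : set R) : \bar R :=
  ereal_sup [set `|x - y|%:E | x in U & y in U].

(* |U|^s, where the empty set contributes 0 also for s = 0, so that the
   0-dimensional measure below is the counting measure. *)
Definition diam_pow (s : R) (U : set R) : \bar R :=
  if U == set0 then 0 else diam U `^ s.

Definition hausdorff_content (s delta : R) (S : set R) : \bar R :=
  ereal_inf [set \sum_(0 <= i <oo) diam_pow s (U i) | U in
    [set U : nat -> set R |
      S `<=` \bigcup_i U i /\ forall i, diam (U i) <= delta%:E]].

(* The content is nonincreasing in delta, so the limit as delta -> 0+ is a
   supremum. *)
Definition hausdorff_measure (s : R) (S : set R) : \bar R :=
  ereal_sup [set hausdorff_content s delta S | delta in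
    [set delta : R | (0 < delta)%R]].

Definition hausdorff_dim (S : set R) : \bar R :=
  ereal_inf [set s%:E | s in
    [set s : R | (0 <= s)%R /\ hausdorff_measure s S = 0]].

End HausdorffDimension.

Section DigitSets.
Variable R : realType.

Definition minkowski_sum (X Y : set R) : set R :=
  [set x + y | x in X & y in Y].

(* The digit a_i of the expansion is a (i - 1) here. *)
Definition cantor_digits (n : nat) (A : set nat) : set R :=
  [set x | exists2 a : nat -> nat, (forall k, A (a k)) &
    [series (a k)%:R / n%:R ^+ k.+1 : R]_k @ \oo --> x].

Definition good (n : nat) (A : set nat) : Prop :=
  [/\ (2 <= n)%N, A 0%N, A n.-1, A `<=` `I_n &
      minkowski_sum (cantor_digits n A) (cantor_digits n A) = `[0, 2]%classic].

Definition uniqueness_set (n : nat) (A : set nat) : set R :=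
  [set z | minkowski_sum (cantor_digits n A) (cantor_digits n A) z /\
    exists! xy : R * R,
      [/\ cantor_digits n A xy.1, cantor_digits n A xy.2 & z = xy.1 + xy.2]].

Definition ifs_map (n m : nat) (x : R) : R := (x + m%:R) / n%:R.

Definition grid_interval (n l : nat) : set R :=
  `[l%:R / n%:R, l.+1%:R / n%:R]%classic.

Definition type_L (n : nat) (A : set nat) (l : nat) : Prop :=
  (exists! st : nat * nat, [/\ A st.1, A st.2 &
     grid_interval n l = ifs_map n (st.1 + st.2) @` `[0, 1]%classic]) /\
  (forall s t : nat, A s -> A t ->
     grid_interval n l `&` ifs_map n (s + t) @` `]1, 2[%classic = set0).

Definition type_R (n : nat) (A : set nat) (l : nat) : Prop :=
  (exists! st : nat * nat, [/\ A st.1, A st.2 &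
     grid_interval n l = ifs_map n (st.1 + st.2) @` `[1, 2]%classic]) /\
  (forall s t : nat, A s -> A t ->
     grid_interval n l `&` ifs_map n (s + t) @` `]0, 1[%classic = set0).

(* Row 0 counts the intervals with l < n, row 1 those with n <= l < 2n;
   column 0 counts type L, column 1 type R. *)
Definition adjacency_mx (n : nat) (A : set nat) : 'M[nat]_2 :=
  \matrix_(i < 2, j < 2)
    #|[set l : 'I_(2 * n) |
        (if i == 0 then (l < n)%N else (n <= l)%N) &&
        (if j == 0 then `[< type_L n A l >] else `[< type_R n A l >])]%SET|.

Definition very_good (n : nat) (A : set nat) : Prop :=
  let M := adjacency_mx n A in
  let a := M 0 0 in let b := M 0 1 in
  let c := M 1 0 in let d := M 1 1 in
  [/\ good n A, ~ A 1%N, ~ A (n - 2)%N &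
      (a + b = c + d)%N \/ (a + c = b + d)%N].

End DigitSets.

(* Main.v *)
Require Import Defs.
From mathcomp Require Import all_boot all_order all_algebra.
From mathcomp Require Import all_classical all_reals all_analysis.
From mathcomp Require Import zify ring lra.
Import Order.TTheory GRing.Theory Num.Theory.
Import numFieldNormedType.Exports.
Local Open Scope classical_set_scope.
Local Open Scope ring_scope.

(** The middle-thirds Cantor set is the model: with base 3 and digits {0, 2},
    the set of uniqueness has dimension ln 2 / ln 3. For a general base n one
    plants the same pattern at both ends of the digit range. Let
    3^(k+2) <= n < 3^(k+3), let T be the set of numbers below 3^k whose base-3
    digits are all 0 or 2, and take

      A = T  u  [2 3^k, n - 1 - 2 3^k]  u  (n - 1 - T).

    The sums T + T are exactly the even numbers below 2 3^k, and the middle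
    block makes all later sums available, so A + A has no two consecutive gaps;
    hence C_A + C_A = [0, 2] ([digit_set_cover], [digit_set_good]). As A is
    symmetric under a -> n - 1 - a, reflection exchanges intervals of type L
    with intervals of type R and the two rows of the adjacency matrix have the
    same sum ([adjacency_mx_sym]); this makes A very good.

    Upper bound. If z in U_A is x + y, it is also y + x, so x = y and z = 2 x.
    A digit u of x with 2 u = s + t for distinct s, t in A could be replaced by
    s in one summand and by t in the other, giving a second decomposition of z.
    Only the at most 2^(k+1) digits of T and n - 1 - T escape this
    ([rigid_digitsP]), so U_A lies in twice a Cantor set with 2^(k+1) digits
    ([uniqueness_set_sub]); since n >= 3^(k+2), counting cylinders gives
    dim U_A <= ln 2 / ln 3.

    Lower bound. Conversely, twice any number whose digits are nonzero elements
    of T is in U_A: near 2 u the only sum of two digits is u + u, by parity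
    ([odd_code_rigid]). Taking 2^(k-1) such digits, at mutual distance at least
    2, the map that rereads the digit indices in base 2^(k-1) is Hoelder and
    onto [0, 1]; a cover of U_A is thereby carried to a cover of [0, 1], whose
    Lebesgue measure is bounded below
    ([hausdorff_measure_expansions_neq0]). This gives
    dim U_A >= (k - 1) ln 2 / ((k + 3) ln 3), which tends to ln 2 / ln 3. *)

(** * The digit sets *)

(** The [k] lowest binary digits of [i], doubled and read in base 3; this
    enumerates the numbers below [3 ^ k] with base-3 digits 0 and 2. *)
Fixpoint ternary_code (k i : nat) : nat :=
  if k is k'.+1 then (3 * ternary_code k' i./2 + 2 * odd i)%N else 0%N.

Definition ternary_digits (k : nat) : seq nat :=
  [seq ternary_code k i | i <- iota 0 (2 ^ k)].

Lemma ternary_code_in (k i : nat) :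
  (i < 2 ^ k)%N -> ternary_code k i \in ternary_digits k.
Proof. by move=> hi; apply/mapP; exists i => //; rewrite mem_iota. Qed.

Lemma ternary_digitsS (k x : nat) :
  (x \in ternary_digits k.+1) <->
  exists (y : nat) (b : bool), y \in ternary_digits k /\ x = (3 * y + 2 * b)%N.
Proof.
split=> [/mapP[i] | [y [b [/mapP[i]]]]]; rewrite mem_iota /= add0n => hi.
  move=> ->; exists (ternary_code k i./2), (odd i); split=> //.
  apply: ternary_code_in; move: hi; rewrite expnS; have := odd_double_half i; lia.
move=> -> ->; apply/mapP; exists (b + i.*2)%N.
  by rewrite mem_iota /= add0n expnS; case: b; lia.
by rewrite /= half_bit_double oddD odd_double addbF; case: b.
Qed.

Lemma ternary_digits0 (x : nat) : x \in ternary_digits 0 -> x = 0%N.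
Proof. by rewrite inE => /eqP. Qed.

Lemma mem0_ternary_digits (k : nat) : 0%N \in ternary_digits k.
Proof.
elim: k => [//|k IH]; apply/ternary_digitsS.
by exists 0%N, false.
Qed.

Lemma ternary_digits_lt (k x : nat) : x \in ternary_digits k -> (x < 3 ^ k)%N.
Proof.
elim: k x => [x /ternary_digits0 -> //|k IH x /ternary_digitsS[y [b [/IH hy ->]]]].
by rewrite expnS; case: b; lia.
Qed.

Lemma ternary_digits_even (k x : nat) : x \in ternary_digits k -> ~~ odd x.
Proof.
elim: k x => [x /ternary_digits0 -> //|k IH x /ternary_digitsS[y [b [/IH hy ->]]]].
by case: b; lia.
Qed.

(** Twice a base-3 digit 0, 1 or 2 of [u] is 0 + 0, 2 + 0 or 2 + 2, so [s] and
    [t] can be chosen digit by digit. *)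
Lemma ternary_digits_sum (k u : nat) : (u < 3 ^ k)%N ->
  exists s t : nat,
    [/\ s \in ternary_digits k, t \in ternary_digits k & (s + t = 2 * u)%N].
Proof.
elim: k u => [u hu|k IH u]; first by exists 0%N, 0%N; split=> //; lia.
rewrite expnS => hu.
have [|s [t [hs ht st]]] := IH (u %/ 3)%N; first by lia.
exists (3 * s + 2 * (0 < u %% 3)%N)%N, (3 * t + 2 * (1 < u %% 3)%N)%N; split.
- by apply/ternary_digitsS; exists s, (0 < u %% 3)%N.
- by apply/ternary_digitsS; exists t, (1 < u %% 3)%N.
- have : (u %% 3 < 3)%N by rewrite ltn_mod.
  have := divn_eq u 3.
  by case: (u %% 3)%N => [|[|[|//]]] /=; lia.
Qed.

(** Modulo 3, halves of the last digits satisfy [b1 + b2 = 2 * b] with all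
    three in {0, 1}, which forces [b1 = b2 = b]; then divide by 3. *)
Lemma ternary_digits_uniq_sum (k s t u : nat) :
  s \in ternary_digits k -> t \in ternary_digits k -> u \in ternary_digits k ->
  (s + t = 2 * u)%N -> s = u /\ t = u.
Proof.
elim: k s t u => [s t u /ternary_digits0-> /ternary_digits0-> /ternary_digits0-> //|].
move=> k IH s t u /ternary_digitsS[s' [b1 [hs ->]]].
move=> /ternary_digitsS[t' [b2 [ht ->]]] /ternary_digitsS[u' [b [hu ->]]] e.
have [e1 e2] : b1 = b /\ b2 = b by case: b1 b2 b {IH hs ht hu} e => [] [] [] /=; lia.
subst b1 b2; have [|-> ->] := IH s' t' u' hs ht hu; last by [].
by lia.
Qed.

Lemma ternary_code_gap (k i j : nat) : (i < j < 2 ^ k)%N ->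
  (ternary_code k i + 2 <= ternary_code k j)%N.
Proof.
elim: k i j => [i j|k IH i j]; first by lia.
rewrite expnS => hij; rewrite /=.
have hi := odd_double_half i; have hj := odd_double_half j.
have [e|ne] := eqVneq i./2 j./2.
  rewrite e in hi *; move: hi hj; case: (odd i); case: (odd j); lia.
have := IH i./2 j./2; move: hi hj; case: (odd i); case: (odd j); lia.
Qed.

(** The middle block starts at [2 * 3 ^ k], just beyond the sums of two elements
    of [ternary_digits k]; it can neither disturb these sums nor leave a gap of
    length two after them. *)
Definition digit_set (n k : nat) : set nat :=
  [set x | [|| x \in ternary_digits k, (2 * 3 ^ k <= x < n - 2 * 3 ^ k)%N |
           (x < n)%N && (n - 1 - x \in ternary_digits k)%N]].

Section DigitSet.
Variables n k : nat.
Hypothesis hn : (6 * 3 ^ k < n)%N.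
Let A := digit_set n k.
Let m_gt0 : (0 < 3 ^ k)%N. Proof. by rewrite expn_gt0. Qed.

Lemma digit_set_lt (x : nat) : A x -> (x < n)%N.
Proof. by case/or3P => [/ternary_digits_lt|/andP[]|/andP[]]; lia. Qed.

Lemma digit_set_sym (x : nat) : (x < n)%N -> A x -> A (n - 1 - x)%N.
Proof.
move=> hx /or3P[h|h|/andP[_ h]]; apply/or3P; [apply: Or33|apply: Or32|exact: Or31].
- by rewrite subKn //; [apply/andP; split=> //; lia|lia].
- by lia.
Qed.

Lemma digit_set_ternary (x : nat) : x \in ternary_digits k -> A x.
Proof. by move=> h; apply/or3P; apply: Or31. Qed.

Lemma digit_set_mid (x : nat) : (2 * 3 ^ k <= x < n - 2 * 3 ^ k)%N -> A x.
Proof. by move=> h; apply/or3P; apply: Or32. Qed.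

Lemma digit_set0 : A 0%N.
Proof. exact/digit_set_ternary/mem0_ternary_digits. Qed.

Lemma digit_set_max : A n.-1.
Proof. by rewrite -subn1 -[X in A X]subn0; apply: digit_set_sym digit_set0; lia. Qed.

Lemma digit_set_small (x : nat) : A x -> (x < 2 * 3 ^ k)%N -> x \in ternary_digits k.
Proof. by case/or3P => [//|/andP[]|/andP[? /ternary_digits_lt]]; lia. Qed.

Lemma digit_set1 : ~ A 1%N.
Proof.
move=> h; suff: ~~ odd 1 by [].
by apply: (ternary_digits_even k); apply: digit_set_small h _; lia.
Qed.

Lemma digit_set_n2 : ~ A (n - 2)%N.
Proof.
move=> /digit_set_sym h; apply: digit_set1.
by have := h _; rewrite (_ : n - 1 - (n - 2) = 1)%N; [apply|]; lia.
Qed.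

(** Every grid interval lies in some [S_(s + t)([0, 2])]. Below [2 * 3 ^ k] the
    sums are the even numbers; from there to [n] adding a digit 0 or the left
    end of the middle block to the middle block suffices; the rest is
    symmetric. *)
Lemma digit_set_cover (l : nat) : (l < 2 * n)%N ->
  exists s t : nat, [/\ A s, A t & l = (s + t)%N \/ l = (s + t).+1].
Proof.
move=> hl.
wlog hl2 : l hl / (l < n)%N => [wl|].
  have [/(wl _ hl)//|hl2] := ltnP l n.
  have [|| s [t [hs ht h]]] := wl (2 * n - 1 - l)%N; [lia|lia|].
  have := digit_set_lt _ hs; have := digit_set_lt _ ht => ? ?.
  exists (n - 1 - s)%N, (n - 1 - t)%N; split; [exact: digit_set_sym|exact: digit_set_sym|].
  by case: h => h; [right|left]; lia.
have [h1|h1] := ltnP l (2 * 3 ^ k).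
  have [|s [t [/digit_set_ternary hs /digit_set_ternary ht e]]] :=
    @ternary_digits_sum k l./2; first by lia.
  by exists s, t; split=> //; have := odd_double_half l; case: (odd l) => /= ?; [right|left]; lia.
have [h2|h2] := ltnP l (n - 2 * 3 ^ k).
  by exists 0%N, l; split; [exact: digit_set0|apply: digit_set_mid; lia|left].
exists (2 * 3 ^ k)%N, (l - 2 * 3 ^ k)%N.
by split; [apply: digit_set_mid; lia|apply: digit_set_mid; lia|left; lia].
Qed.

(** Sums below [2 * 3 ^ k] only involve even digits, so [2 * u - 1] and
    [2 * u + 1] are no sums at all. *)
Lemma digit_set_uniq_sum (s t u : nat) : u \in ternary_digits k -> A s -> A t ->
  (2 * u <= (s + t).+1)%N -> (s + t <= (2 * u).+1)%N -> s = u /\ t = u.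
Proof.
move=> hu hs ht h1 h2; have hu3 := ternary_digits_lt _ _ hu.
have hs' : s \in ternary_digits k by apply: digit_set_small hs _; lia.
have ht' : t \in ternary_digits k by apply: digit_set_small ht _; lia.
apply: (ternary_digits_uniq_sum k) => //.
have := ternary_digits_even _ _ hs'; have := ternary_digits_even _ _ ht'; lia.
Qed.

Definition rigid_digits : seq nat :=
  ternary_digits k ++ [seq (n - 1 - x)%N | x <- ternary_digits k].

(** A digit of the middle block is the midpoint of two other digits: of its
    neighbours inside the block, and at the ends of the block of an extreme
    digit (0 or [n - 1]) and a digit of the block. *)
Lemma rigid_digitsP (u : nat) : A u ->
  (forall s t : nat, A s -> A t -> (s + t = 2 * u)%N -> s = u) -> u \in rigid_digits.
Proof.
rewrite mem_cat => /or3P[-> //|hu|/andP[un hu] _]; last first.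
  by apply/orP; right; apply/mapP; exists (n - 1 - u)%N => //; lia.
move=> h; exfalso.
have [e|ne] := eqVneq u (2 * 3 ^ k)%N.
  have := h 0%N (2 * u)%N digit_set0 (digit_set_mid _ _) erefl; lia.
have [e'|ne'] := eqVneq u (n - 1 - 2 * 3 ^ k)%N.
  have := h n.-1 (2 * u - n.-1)%N digit_set_max (digit_set_mid _ _) _; lia.
have := h u.-1 u.+1 (digit_set_mid _ _) (digit_set_mid _ _) _; lia.
Qed.

End DigitSet.

(** * Expansions in base n *)

Section Expansions.
Variable R : realType.

Definition expansion (n : nat) (a : nat -> nat) : R ^nat :=
  [series (a k)%:R / n%:R ^+ k.+1 : R]_k.

Definition expansion_value (n : nat) (a : nat -> nat) : R := limn (expansion n a).

Definition tail (a : nat -> nat) : nat -> nat := fun k => a k.+1.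

Section Base.
Variable n : nat.
Hypothesis n2 : (2 <= n)%N.

Let n_gt0 : 0 < n%:R :> R. Proof. by rewrite ltr0n; lia. Qed.
Let n_neq0 : n%:R != 0 :> R. Proof. by rewrite pnatr_eq0; lia. Qed.

Lemma cvg_geometric_base (c : R) : (c / n%:R ^+ k) @[k --> \oo] --> (0 : R).
Proof.
have -> : (fun k : nat => c / n%:R ^+ k) = (fun k => c * n%:R^-1 ^+ k).
  by apply/funext => k; rewrite exprVn.
rewrite -[X in _ --> X](mulr0 c); apply: cvgM; first exact: cvg_cst.
apply: cvg_expr; rewrite ger0_norm ?invr_ge0 ?ltW// invf_lt1// ltr1n; lia.
Qed.

Lemma expansionS (a : nat -> nat) (k : nat) :
  expansion n a k.+1 = ((a 0%N)%:R + expansion n (tail a) k) / n%:R.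
Proof.
rewrite /expansion /series /= big_nat_recl//= mulrDl mulr_suml expr1; congr (_ + _).
by apply: eq_bigr => i _; rewrite /tail exprSr invfM mulrA.
Qed.

Lemma expansion_le1 (a : nat -> nat) (k : nat) : (forall i, (a i < n)%N) ->
  expansion n a k <= 1.
Proof.
elim: k a => [|k IH] a ha; first by rewrite /expansion /series /= big_nil.
rewrite expansionS ler_pdivrMr// mul1r.
have := IH (tail a) (fun i => ha i.+1).
have : (a 0%N).+1%:R <= n%:R :> R by rewrite ler_nat; apply: ha.
rewrite -natr1; lra.
Qed.

Lemma expansion_nondecreasing (a : nat -> nat) :
  {homo expansion n a : i j / (i <= j)%N >-> i <= j}.
Proof.
apply/nondecreasing_seqP => k; rewrite /expansion seriesSr lerDl.
by rewrite divr_ge0// exprn_ge0.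
Qed.

Lemma expansion_cvg (a : nat -> nat) : (forall i, (a i < n)%N) ->
  expansion n a @ \oo --> expansion_value n a.
Proof.
move=> ha; apply: nondecreasing_is_cvgn; first exact: expansion_nondecreasing.
by exists 1 => _ [k _ <-]; exact: expansion_le1.
Qed.

Lemma expansion_valueE (a : nat -> nat) (x : R) :
  expansion n a @ \oo --> x -> expansion_value n a = x.
Proof. by move=> h; apply/cvg_lim. Qed.

Lemma expansion_value_cons (a : nat -> nat) : (forall i, (a i < n)%N) ->
  expansion_value n a = ((a 0%N)%:R + expansion_value n (tail a)) / n%:R.
Proof.
move=> ha; apply: expansion_valueE.
rewrite -(cvg_shiftS (expansion n a)).
under eq_fun do rewrite expansionS.
apply: cvgM; last exact: cvg_cst.
by apply: cvgD; [exact: cvg_cst | apply: expansion_cvg => i; apply: ha].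
Qed.

Lemma expansion_value_ge0 (a : nat -> nat) : (forall i, (a i < n)%N) ->
  0 <= expansion_value n a.
Proof.
move=> ha; apply: limr_ge; first by apply/cvg_ex; exists (expansion_value n a); exact: expansion_cvg.
near=> k; apply: sumr_ge0 => i _; by rewrite divr_ge0// exprn_ge0.
Unshelve. all: by end_near.
Qed.

Lemma expansion_value_le1 (a : nat -> nat) : (forall i, (a i < n)%N) ->
  expansion_value n a <= 1.
Proof.
move=> ha; apply: limr_le; first by apply/cvg_ex; exists (expansion_value n a); exact: expansion_cvg.
near=> k; exact: expansion_le1.
Unshelve. all: by end_near.
Qed.

Lemma expansion_value_add (a b c : nat -> nat) :
  (forall i, (a i < n)%N) -> (forall i, (b i < n)%N) ->
  (forall i, c i = (a i + b i)%N) ->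
  expansion n c @ \oo --> expansion_value n a + expansion_value n b.
Proof.
move=> ha hb hc.
have -> : expansion n c = expansion n a \+ expansion n b.
  apply/funext => k; rewrite /expansion /series /= -big_split; apply: eq_bigr => i _ /=.
  by rewrite hc natrD mulrDl.
by apply: cvgD; exact: expansion_cvg.
Qed.

Lemma expansion_value_inj_at (i : nat) (a b : nat -> nat) :
  (forall j, (a j < n)%N) -> (forall j, (b j < n)%N) ->
  (forall j, j != i -> a j = b j) ->
  expansion_value n a = expansion_value n b -> a i = b i.
Proof.
elim: i a b => [|i IH] a b ha hb hab;
  rewrite (expansion_value_cons a ha) (expansion_value_cons b hb) => /(divIf n_neq0).
  have -> : tail a = tail b by apply/funext => j; apply: hab.
  by move/addIr => /eqP; rewrite eqr_nat => /eqP.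
rewrite (hab 0%N)// => /addrI; apply: IH => [j|j|j ij]; [exact: ha|exact: hb|].
exact: hab.
Qed.

(** The greedy algorithm: if each [y] in [[0, c]] admits a digit whose removal,
    after multiplication by [n], stays in [[0, c]], then iterating yields an
    expansion; the remainders are at most [c / n ^ k]. *)
Lemma expansion_exists (P : nat -> Prop) (c z : R) :
  (forall y, 0 <= y <= c -> exists m, P m /\ 0 <= n%:R * y - m%:R <= c) ->
  0 <= z <= c -> exists a : nat -> nat, (forall k, P (a k)) /\ expansion n a @ \oo --> z.
Proof.
move=> step hz.
have /choice[f hf] : forall y, exists m, 0 <= y <= c -> P m /\ 0 <= n%:R * y - m%:R <= c.
  move=> y; have [h|h] := pselect (0 <= y <= c); last by exists 0%N.
  by have [m hm] := step y h; exists m.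
pose r := fix r (k : nat) : R := if k is k'.+1 then n%:R * r k' - (f (r k'))%:R else z.
have hr k : 0 <= r k <= c by elim: k => [//|k /hf[_]].
exists (fun k => f (r k)); split; first by move=> k; exact: (hf _ (hr k)).1.
have e k : z - r k / n%:R ^+ k = expansion n (fun k => f (r k)) k.
  elim: k => [|k IH]; first by rewrite /expansion /series /= big_nil expr0 divr1 subrr.
  rewrite /expansion seriesSr -[series _ k]/(expansion n _ k) -IH /=.
  by rewrite exprS; field; rewrite n_neq0 expf_neq0.
rewrite -[X in X @ _ --> _](_ : (fun k => z - r k / n%:R ^+ k) = _); last exact/funext.
rewrite -[X in _ --> X]subr0; apply: cvgB; first exact: cvg_cst.
apply: (squeeze_cvgr _ (cvg_cst 0) (cvg_geometric_base c)).
near=> k; have /andP[h0 h1] := hr k.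
by rewrite divr_ge0 ?exprn_ge0//= ler_pM2r// invr_gt0 exprn_gt0.
Unshelve. all: by end_near.
Qed.

End Base.
End Expansions.

(** * Hausdorff dimension: upper bounds *)

Section HausdorffUpper.
Variable R : realType.

Lemma diam_pow_ge0 (s : R) (U : set R) : (0 <= diam_pow s U)%E.
Proof. by rewrite /diam_pow; case: ifP => // _; exact: poweR_ge0. Qed.

Lemma diam_pow0 (s : R) : diam_pow s (set0 : set R) = 0%E.
Proof. by rewrite /diam_pow eqxx. Qed.

Lemma diam_ge0 (U : set R) : U !=set0 -> (0 <= diam U)%E.
Proof.
case=> x Ux; apply: le_ereal_sup_tmp; exists `|x - x|%:E; last by rewrite lee_fin.
by exists x => //; exists x.
Qed.

Lemma diam_le (U : set R) (r : R) :
  (forall x y, U x -> U y -> `|x - y| <= r) -> (diam U <= r%:E)%E.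
Proof. by move=> h; apply/ereal_supP => _ [x Ux [y Uy <-]]; rewrite lee_fin h. Qed.

Lemma diam_pow_le (s r : R) (U : set R) : 0 <= s -> 0 <= r ->
  (diam U <= r%:E)%E -> (diam_pow s U <= (r `^ s)%:E)%E.
Proof.
move=> s0 r0 hd; rewrite /diam_pow; case: ifPn => [_|/set0P U0].
  by rewrite lee_fin powR_ge0.
by rewrite -poweR_EFin; apply: gt0_ler_poweR; rewrite ?in_itv//= ?leey ?andbT ?diam_ge0.
Qed.

Lemma hausdorff_measure_ge0 (s : R) (S : set R) : (0 <= hausdorff_measure s S)%E.
Proof.
apply: le_ereal_sup_tmp; exists (hausdorff_content s 1 S); first by exists 1 => //=.
apply/ereal_infP => _ [U _ <-]; apply: nneseries_ge0 => i _ _; exact: diam_pow_ge0.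
Qed.

Lemma hausdorff_content_le (s delta r : R) (S : set R) (L : seq R) :
  0 <= s -> 0 <= r <= delta ->
  S `<=` [set x | exists c, c \in L /\ c <= x <= c + r] ->
  (hausdorff_content s delta S <= ((size L)%:R * r `^ s)%:E)%E.
Proof.
move=> s0 /andP[r0 rd] SL.
pose U i : set R :=
  if (i < size L)%N then [set x | L`_i <= x <= L`_i + r] else set0.
have Ur i : (diam (U i) <= r%:E)%E.
  apply: diam_le => x y; rewrite /U; case: ifP => //= _ /andP[? ?] /andP[? ?].
  by rewrite ler_norml; apply/andP; split; lra.
apply: ge_ereal_inf; exists (\sum_(0 <= i <oo) diam_pow s (U i))%E.
  exists U => //; split; last by move=> i; apply: le_trans (Ur i) _; rewrite lee_fin.
  move=> x /SL[c [cL hc]]; exists (index c L) => //=.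
  by rewrite /U index_mem cL /= nth_index.
rewrite (nneseries_split 0 (size L)); last by move=> *; exact: diam_pow_ge0.
rewrite add0n eseries0 ?adde0; last first.
  by move=> i hi _; rewrite /U ltnNge hi /= diam_pow0.
have -> : ((size L)%:R * r `^ s)%:E = (\sum_(0 <= i < size L) (r `^ s)%:E)%E.
  by rewrite sumEFin big_const_nat subn0 iter_addr_0 mulr_natl.
by apply: lee_sum => i _; exact: diam_pow_le.
Qed.

Lemma powR_invX (a s : R) (j : nat) : 0 < a ->
  (a^-1 ^+ j) `^ s = (a `^ s)^-1 ^+ j.
Proof.
move=> a0; have a1 : 0 <= a^-1 by rewrite invr_ge0 ltW.
elim: j => [|j IH]; first by rewrite !expr0 powR1.
rewrite !exprS powRM ?exprn_ge0// IH; congr (_ * _).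
by rewrite -powR_inv1 ?(ltW a0)// -powRrM mulrC powRrM powR_inv1 ?powR_ge0.
Qed.

(** The left endpoints of the level-[j] cylinders, each of length [n ^ - j]. *)
Fixpoint cylinders (n : nat) (D : seq nat) (j : nat) : seq R :=
  if j is j'.+1 then
    [seq (d%:R + x) / n%:R | d <- D, x <- cylinders n D j']
  else [:: 0].

Lemma size_cylinders (n : nat) (D : seq nat) (j : nat) :
  size (cylinders n D j) = (size D ^ j)%N.
Proof. by elim: j => [//|j IH]; rewrite /= size_allpairs IH expnS. Qed.

Lemma cylinders_cover (n : nat) (D : seq nat) (j : nat) (a : nat -> nat) :
  (2 <= n)%N -> {in D, forall d, (d < n)%N} -> (forall i, a i \in D) ->
  exists c, c \in cylinders n D j /\
    c <= expansion_value R n a <= c + n%:R^-1 ^+ j.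
Proof.
move=> n2 hD; have n0 : 0 < n%:R :> R by rewrite ltr0n; lia.
elim: j a => [|j IH] a ha.
  exists 0; rewrite inE eqxx expr0 add0r; split=> //.
  by rewrite expansion_value_ge0 ?expansion_value_le1// => i; exact: hD.
have [c [hc /andP[h1 h2]]] := IH (tail a) (fun i => ha i.+1).
exists (((a 0%N)%:R + c) / n%:R); split.
  by apply/allpairsP; exists (a 0%N, c); split=> //=; exact: ha.
rewrite expansion_value_cons//; last by move=> i; exact: hD.
rewrite ler_pM2r ?invr_gt0// lerD2l h1 /= exprSr -mulrDl ler_pM2r ?invr_gt0//.
by rewrite -addrA lerD2l.
Qed.

(** The [size D ^ j] cylinders of level [j] have total [s]-mass
    [2 ^ s * (size D / n ^ s) ^ j], which tends to 0. *)
Lemma hausdorff_measure_expansions_eq0 (n : nat) (D : seq nat) (S : set R) (s : R) :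
  (2 <= n)%N -> {in D, forall d, (d < n)%N} -> 0 <= s ->
  (size D)%:R < n%:R `^ s ->
  S `<=` [set 2 * expansion_value R n a | a in [set a | forall i, a i \in D]] ->
  hausdorff_measure s S = 0%E.
Proof.
move=> n2 hD s0 Ks SD; have n0 : 0 < n%:R :> R by rewrite ltr0n; lia.
apply/eqP; rewrite eq_le hausdorff_measure_ge0 andbT.
apply/ereal_supP => _ [delta /= d0 <-]; apply/lee_addgt0Pr => e e0; rewrite add0e.
have ns0 : 0 < n%:R `^ s by rewrite powR_gt0.
have hq : `|(size D)%:R / n%:R `^ s| < 1.
  by rewrite ger0_norm ?divr_ge0 ?powR_ge0// ltr_pdivrMr// mul1r.
have c1 : (2 * n%:R^-1 ^+ j) @[j --> \oo] --> (0 : R).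
  rewrite -[X in _ --> X](mulr0 2); apply: cvgM; first exact: cvg_cst.
  by apply: cvg_expr; rewrite ger0_norm ?invr_ge0 ?ltW// invf_lt1// ltr1n; lia.
have c2 : (2 `^ s * ((size D)%:R / n%:R `^ s) ^+ j) @[j --> \oo] --> (0 : R).
  rewrite -[X in _ --> X](mulr0 (2 `^ s)); apply: cvgM; first exact: cvg_cst.
  exact: cvg_expr.
have [j [jd je]] : exists j : nat, 2 * n%:R^-1 ^+ j <= delta /\
    2 `^ s * ((size D)%:R / n%:R `^ s) ^+ j <= e.
  have [] // := @filter_ex _ \oo _ (fun j : nat => 2 * n%:R^-1 ^+ j <= delta /\
    2 `^ s * ((size D)%:R / n%:R `^ s) ^+ j <= e) _; last by move=> j hj; exists j.
  near=> j; split; apply: ltW; near: j; [exact: (cvgr_lt _ c1)|exact: (cvgr_lt _ c2)].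
have p0 : 0 <= n%:R^-1 ^+ j :> R by rewrite exprn_ge0 // invr_ge0 ltW.
apply: le_trans (hausdorff_content_le s delta (2 * n%:R^-1 ^+ j) S
  [seq 2 * c | c <- cylinders n D j] s0 _ _) _.
- by rewrite mulr_ge0.
- move=> _ /SD[a ha <-]; have [c [hc /andP[h1 h2]]] := cylinders_cover n D j a n2 hD ha.
  exists (2 * c); split; first exact: map_f.
  by apply/andP; split; lra.
- rewrite lee_fin size_map size_cylinders; apply: le_trans je.
  by rewrite natrX powRM// powR_invX// mulrCA -exprMn.
Unshelve. all: by end_near.
Qed.

End HausdorffUpper.

(** * Hausdorff dimension: lower bounds *)

Section HausdorffLower.
Variable R : realType.

Section Gap.
Variables (n N : nat) (e : nat -> nat).
Hypotheses (n2 : (2 <= n)%N) (N2 : (2 <= N)%N).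
Hypothesis e_lt : forall i, (i < N)%N -> (e i < n)%N.
Hypothesis e_gap : forall i j, (i < j < N)%N -> (e i + 2 <= e j)%N.

Let X (a : nat -> nat) : R := expansion_value R n (e \o a).
Let G (a : nat -> nat) : R := expansion_value R N a.
Let n0 : 0 < n%:R :> R. Proof. by rewrite ltr0n; lia. Qed.
Let N0 : 0 < N%:R :> R. Proof. by rewrite ltr0n; lia. Qed.

Let XS (a : nat -> nat) : (forall i, (a i < N)%N) ->
  X a = ((e (a 0%N))%:R + X (tail a)) / n%:R.
Proof. by move=> ha; apply: (expansion_value_cons R _ n2) => i; exact: e_lt. Qed.

Let GS (a : nat -> nat) : (forall i, (a i < N)%N) ->
  G a = ((a 0%N)%:R + G (tail a)) / N%:R.
Proof. exact: expansion_value_cons. Qed.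

(** Two points that differ first at digit [j] are [n ^ - j.+1] apart, because
    the digits there differ by at least 2 while the tails differ by at most 1;
    after rereading the digit indices in base [N] they are still in a common
    cylinder of length [N ^ - j]. *)
Lemma expansion_separation (j : nat) (a b : nat -> nat) :
  (forall i, (a i < N)%N) -> (forall i, (b i < N)%N) ->
  (forall i, (i < j)%N -> a i = b i) -> a j <> b j ->
  n%:R^-1 ^+ j.+1 <= `|X a - X b| /\ `|G a - G b| <= N%:R^-1 ^+ j.
Proof.
elim: j a b => [|j IH] a b ha hb hab ne.
  have ea (c : nat -> nat) (hc : forall i, (c i < N)%N) i : ((e \o c) i < n)%N by exact: e_lt.
  split; last first.
    rewrite expr0 ler_norml; have := expansion_value_ge0 R _ N2 _ ha.
    have := expansion_value_ge0 R _ N2 _ hb; have := expansion_value_le1 R _ N2 _ ha.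
    by have := expansion_value_le1 R _ N2 _ hb; rewrite /G => *; apply/andP; split; lra.
  wlog ab : a b ha hb hab ne / (a 0%N < b 0%N)%N => [wl|].
    have [|h|/ne//] := ltngtP (a 0%N) (b 0%N); first exact: wl.
    by rewrite distrC; apply: wl => //; exact/nesym.
  have hgap : (e (a 0%N))%:R + 2 <= (e (b 0%N))%:R :> R.
    by rewrite -natrD ler_nat e_gap// ab hb.
  rewrite expr1 distrC (XS a ha) (XS b hb).
  rewrite -mulrBl normrM [`|_^-1|]ger0_norm ?invr_ge0 ?(ltW n0)// ler_pMl ?invr_gt0//.
  apply: le_trans (ler_norm _).
  have t0 := expansion_value_ge0 R _ n2 (e \o tail b) (fun i => ea _ hb i.+1).
  have t1 := expansion_value_le1 R _ n2 (e \o tail a) (fun i => ea _ ha i.+1).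
  rewrite /X; lra.
have [h1 h2] := IH (tail a) (tail b) (fun i => ha i.+1) (fun i => hb i.+1)
  (fun i hi => hab i.+1 hi) ne.
have cancel (c x y : R) : c + x - (c + y) = x - y by ring.
rewrite (XS a ha) (XS b hb) (GS a ha) (GS b hb) hab// -!mulrBl !cancel !normrM.
rewrite ![`|_^-1|]ger0_norm ?invr_ge0 ?(ltW n0) ?(ltW N0)//.
by rewrite exprSr [N%:R^-1 ^+ _]exprSr !ler_pM2r ?invr_gt0.
Qed.

Lemma expansion_hoelder (s : R) (a b : nat -> nat) : 0 <= s -> n%:R `^ s <= N%:R ->
  (forall i, (a i < N)%N) -> (forall i, (b i < N)%N) ->
  `|G a - G b| <= N%:R * `|X a - X b| `^ s.
Proof.
move=> s0 hs ha hb.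
have [eab|/existsNP ne] := pselect (forall i, a i = b i).
  have -> : a = b by apply/funext.
  by rewrite !subrr normr0 mulr_ge0 ?powR_ge0// ltW.
have exj : exists j, a j != b j by case: ne => j /eqP; exists j.
have [j /eqP hj jmin] := ex_minnP exj.
have [|h1 h2] := expansion_separation j a b ha hb _ hj.
  by move=> i ij; apply/eqP; apply: contraTT ij => /jmin; rewrite -leqNgt.
apply: le_trans h2 _.
have h3 : (n%:R^-1 ^+ j.+1) `^ s <= `|X a - X b| `^ s.
  by rewrite ge0_ler_powR// ?nnegrE// exprn_ge0// invr_ge0 ltW.
apply: le_trans (ler_wpM2l (ltW N0) h3).
rewrite powR_invX//.
have h4 : N%:R^-1 ^+ j.+1 <= (n%:R `^ s)^-1 ^+ j.+1.
  apply: lerXn2r; rewrite ?nnegrE ?invr_ge0 ?powR_ge0 ?(ltW N0)//.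
  by rewrite lef_pV2// posrE ?powR_gt0.
apply: le_trans (ler_wpM2l (ltW N0) h4).
by rewrite exprS mulrA divff ?mul1r// gt_eqF.
Qed.

(** A mass distribution argument in disguise: the Hoelder map [X a |-> G a] is
    onto [[0, 1]] and sends a set of diameter [d] into an interval of length
    [2 * N * d ^ s], so countable subadditivity of Lebesgue measure bounds the
    content from below, whatever the mesh of the cover. *)
Lemma hausdorff_measure_expansions_neq0 (S : set R) (s : R) :
  0 <= s -> n%:R `^ s <= N%:R ->
  [set 2 * X a | a in [set a | forall i, (a i < N)%N]] `<=` S ->
  hausdorff_measure s S <> 0%E.
Proof.
move=> s0 hs sub_S hm.
have : ((2 * N%:R)^-1%:E <= hausdorff_measure s S)%E; last first.
  by rewrite hm lee_fin invr_le0; have := N0; lra.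
apply: le_ereal_sup_tmp; exists (hausdorff_content s 1 S); first by exists 1 => /=.
apply/ereal_infP => _ [U [SU dU] <-].
have main : (1%:E <= (2 * N%:R)%:E * \sum_(0 <= i <oo) diam_pow s (U i))%E.
  rewrite -nneseriesZl; last by move=> i _; exact: diam_pow_ge0.
  pose V i : set R := [set G a | a in [set a | (forall k, (a k < N)%N) /\ U i (2 * X a)]].
  have /choice[J hJ] : forall i, exists J : R * R, V i `<=` `[J.1, J.2] /\
      (lebesgue_measure (`[J.1, J.2]%classic : set R) <= (2 * N%:R)%:E * diam_pow s (U i))%E.
    move=> i; have [V0|/set0P[_ [a [ha Ua] _]]] := eqVneq (V i) set0.
      (* (1, 0) stands for an empty interval. *)
      exists (1, 0); rewrite V0; split; first exact: sub0set.
      by rewrite lebesgue_measure_itv /= lte_fin ltr10 mule_ge0 ?diam_pow_ge0//.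
    have U0 : U i !=set0 by exists (2 * X a).
    have dfin : diam (U i) \is a fin_num.
      by apply/fin_real; rewrite (lt_le_trans _ (diam_ge0 _ _ U0)) ?ltNy0// (le_lt_trans (dU i)) ?ltry.
    pose d := fine (diam (U i)).
    have dE : diam_pow s (U i) = (d `^ s)%:E.
      rewrite /diam_pow ifF; last by apply/negbTE/set0P.
      by rewrite -(fineK dfin) poweR_EFin.
    have d0 : 0 <= d by rewrite fine_ge0// diam_ge0.
    have ds0 : 0 <= N%:R * d `^ s by rewrite mulr_ge0 ?powR_ge0 ?ltW.
    exists (G a - N%:R * d `^ s, G a + N%:R * d `^ s); split.
      move=> _ [b [hb Ub] <-] /=; rewrite in_itv /= -ler_distl.
      apply: le_trans (expansion_hoelder _ _ _ s0 hs hb ha) _.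
      rewrite ler_wpM2l ?(ltW N0)// ge0_ler_powR// ?nnegrE//.
      apply: (@le_trans _ _ `|2 * X b - 2 * X a|).
        by rewrite -mulrBr normrM ger0_norm// ler_peMl// ler1n.
      rewrite -lee_fin /d fineK//; apply: ereal_sup_ubound.
      by exists (2 * X b) => //; exists (2 * X a).
    rewrite lebesgue_measure_itv /= dE -EFinM lte_fin.
    case: ifP => _; last by rewrite lee_fin -mulrA mulr_ge0.
    by rewrite -EFinB lee_fin; lra.
  have -> : 1%:E = lebesgue_measure (`[0, 1]%classic : set R).
    by rewrite lebesgue_measure_itv /= lte_fin ltr01 -EFinB subr0.
  have mF i : measurable (`[(J i).1, (J i).2]%classic : set R) by exact: measurable_itv.
  have covered : `[0, 1]%classic `<=` \bigcup_i (`[(J i).1, (J i).2]%classic : set R).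
    move=> x /=; rewrite in_itv /= => hx.
    have [y hy|a [ha hax]] := @expansion_exists R N N2 (fun m => (m < N)%N) 1 x _ hx.
      (* The digit of y is the integer part of N y, except at y = 1, where the
         expansion continues with the digit N - 1. *)
      have [y1|ylt] := eqVneq y 1.
        exists N.-1; split; first by lia.
        have -> : N.-1%:R = N%:R - 1 :> R by rewrite -subn1 natrB//; lia.
        by rewrite y1; lra.
      have Ny0 : 0 <= N%:R * y by case/andP: hy => h _; rewrite mulr_ge0// ltW.
      have /andP[t1 t2] := truncn_itv Ny0.
      exists (Num.trunc (N%:R * y)); split.
        rewrite truncn_lt_nat// gtr_pMr// lt_neqAle ylt; by case/andP: hy.
      by move: t2; rewrite -natr1; lra.
    have Ga : G a = x := expansion_valueE _ _ _ _ hax.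
    have [i _ Ui] := SU _ (sub_S _ (ex_intro2 _ _ a ha erefl)).
    by exists i => //; apply: (hJ i).1; exists a.
  apply: le_trans (measure_sigma_subadditive lebesgue_measure mF _ covered) _.
    exact: measurable_itv.
  by apply: lee_nneseries => // i _; exact: (hJ i).2.
have M0 : 0 < 2 * N%:R :> R by rewrite mulr_gt0.
by rewrite -(@lee_pmul2l _ (2 * N%:R)%:E)// -EFinM divff ?gt_eqF.
Qed.

End Gap.
End HausdorffLower.

(** * Symmetry of the adjacency matrix *)

Section Grid.
Variables (R : realType) (n : nat) (A : set nat).
Hypothesis n_gt0 : (0 < n)%N.

Let n0 : 0 < n%:R :> R. Proof. by rewrite ltr0n. Qed.

Lemma ifs_map_itvcc (m : nat) (u v : R) :
  ifs_map n m @` `[u, v] = `[(u + m%:R) / n%:R, (v + m%:R) / n%:R]%classic.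
Proof.
apply/seteqP; split=> [_ [x /= + <-]|y /=]; rewrite in_itv /= => /andP[h1 h2].
  by rewrite in_itv /= /ifs_map !ler_pM2r ?invr_gt0// !lerD2r h1.
exists (y * n%:R - m%:R); last by rewrite /ifs_map subrK mulfK ?gt_eqF.
by rewrite /= in_itv /= lerBrDr lerBlDr -ler_pdivrMr ?h1//= -ler_pdivlMr.
Qed.

Lemma ifs_map_itvoo (m : nat) (u v : R) :
  ifs_map n m @` `]u, v[ = `](u + m%:R) / n%:R, (v + m%:R) / n%:R[%classic.
Proof.
apply/seteqP; split=> [_ [x /= + <-]|y /=]; rewrite in_itv /= => /andP[h1 h2].
  by rewrite in_itv /= /ifs_map !ltr_pM2r ?invr_gt0// !ltrD2r h1.
exists (y * n%:R - m%:R); last by rewrite /ifs_map subrK mulfK ?gt_eqF.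
by rewrite /= in_itv /= ltrBrDr ltrBlDr -ltr_pdivrMr ?h1//= -ltr_pdivlMr.
Qed.

Lemma grid_interval_eq (l m : nat) :
  `[m%:R / n%:R, m.+1%:R / n%:R]%classic = grid_interval n l :> set R <-> l = m.
Proof.
split=> [/seteqP[h1 h2]|-> //].
have /= := h1 (m%:R / n%:R); have /= := h2 (l%:R / n%:R).
rewrite /grid_interval /= !in_itv /= !ler_pM2r ?invr_gt0// !lexx !ler_nat !leqnSn => /(_ isT)+ /(_ isT).
lia.
Qed.

Lemma grid_interval_meets (l m : nat) :
  grid_interval n l `&` `]m%:R / n%:R, m.+1%:R / n%:R[%classic = set0 :> set R
  <-> l <> m.
Proof.
split=> [+ e|ne].
  apply/eqP/set0P; rewrite e; exists ((m%:R + 2^-1) / n%:R);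
    split; rewrite /grid_interval /= in_itv /= ?ler_pM2r ?ltr_pM2r ?invr_gt0// -[m.+1]addn1 natrD;
    apply/andP; split; lra.
rewrite -subset0 => x []; rewrite /grid_interval /= !in_itv /= => /andP[h1 h2] /andP[h3 h4]; apply: ne.
have := le_lt_trans h1 h4; have := lt_le_trans h3 h2.
by rewrite !ltr_pM2r ?invr_gt0// !ltr_nat; lia.
Qed.

(** Removes the geometry: the type of an interval only depends on which of [l]
    and [l - 1] are sums of two digits, and in how many ways. *)
Lemma type_LE (l : nat) : type_L R n A l <->
  (exists! st : nat * nat, [/\ A st.1, A st.2 & l = (st.1 + st.2)%N]) /\
  (forall s t, A s -> A t -> l <> (s + t).+1).
Proof.
have e1 m : ifs_map n m @` `[(0:R), 1] = `[m%:R / n%:R, m.+1%:R / n%:R]%classic.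
  by rewrite ifs_map_itvcc add0r -natr1 addrC.
have e2 m : ifs_map n m @` `](1:R), 2[ = `]m.+1%:R / n%:R, m.+2%:R / n%:R[%classic.
  by rewrite ifs_map_itvoo -[m.+2]addn2 natrD -[m.+1]addn1 natrD ![m%:R + _]addrC.
split=> -[[st [[As At hst] u]] h]; split.
- exists st; split; first by split=> //; apply/grid_interval_eq; rewrite hst e1.
  by move=> st' [As' At' h']; apply: u; split=> //; rewrite e1; apply/esym/grid_interval_eq.
- by move=> s t hs ht; apply/grid_interval_meets; rewrite -e2; exact: h.
- exists st; split; first by split=> //; rewrite e1; apply/esym/grid_interval_eq.
  by move=> st' [As' At' h']; apply: u; split=> //; apply/grid_interval_eq; rewrite h' e1.
- by move=> s t hs ht; rewrite e2; apply/grid_interval_meets; exact: h.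
Qed.

Lemma type_RE (l : nat) : type_R R n A l <->
  (exists! st : nat * nat, [/\ A st.1, A st.2 & l = (st.1 + st.2).+1]) /\
  (forall s t, A s -> A t -> l <> (s + t)%N).
Proof.
have e1 m : ifs_map n m @` `[(1:R), 2] = `[m.+1%:R / n%:R, m.+2%:R / n%:R]%classic.
  by rewrite ifs_map_itvcc -[m.+2]addn2 natrD -[m.+1]addn1 natrD ![m%:R + _]addrC.
have e2 m : ifs_map n m @` `](0:R), 1[ = `]m%:R / n%:R, m.+1%:R / n%:R[%classic.
  by rewrite ifs_map_itvoo add0r -natr1 addrC.
split=> -[[st [[As At hst] u]] h]; split.
- exists st; split; first by split=> //; apply/grid_interval_eq; rewrite hst e1.
  by move=> st' [As' At' h']; apply: u; split=> //; rewrite e1; apply/esym/grid_interval_eq.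
- by move=> s t hs ht; apply/grid_interval_meets; rewrite -e2; exact: h.
- exists st; split; first by split=> //; rewrite e1; apply/esym/grid_interval_eq.
  by move=> st' [As' At' h']; apply: u; split=> //; apply/grid_interval_eq; rewrite h' e1.
- by move=> s t hs ht; rewrite e2; apply/grid_interval_meets; exact: h.
Qed.

Hypothesis A_lt : forall x, A x -> (x < n)%N.
Hypothesis A_sym : forall x, (x < n)%N -> A x -> A (n - 1 - x)%N.

(** Replacing each digit [x] by [n - 1 - x] turns a sum [l] into
    [2 * n - 2 - l], and so exchanges the two conditions that define the
    types. *)
Lemma type_LR_sym (l : nat) : (l < 2 * n)%N ->
  type_L R n A l <-> type_R R n A (2 * n - l.+1)%N.
Proof.
move=> hl; rewrite type_LE type_RE.
have inv x : A x -> ((n - 1 - (n - 1 - x)) = x)%N by move=> /A_lt; lia.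
have sym x : A x -> A (n - 1 - x)%N by move=> h; apply: A_sym => //; exact: A_lt.
split=> -[[[s t] [[/= As At hst] u]] h]; split.
- exists (n - 1 - s, n - 1 - t)%N; split=> [|[s' t'] [/= As' At' e]].
    by split=> /=; [exact: sym|exact: sym|]; have := A_lt _ As; have := A_lt _ At; lia.
  have [-> ->] : (s, t) = (n - 1 - s', n - 1 - t')%N; last by rewrite !inv.
  apply: u; split=> /=; [exact: sym|exact: sym|].
  by have := A_lt _ As'; have := A_lt _ At'; lia.
- move=> s' t' As' At' e; apply: (h _ _ (sym _ As') (sym _ At')).
  have := A_lt _ As'; have := A_lt _ At'; lia.
- exists (n - 1 - s, n - 1 - t)%N; split=> [|[s' t'] [/= As' At' e]].
    by split=> /=; [exact: sym|exact: sym|]; have := A_lt _ As; have := A_lt _ At; lia.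
  have [-> ->] : (s, t) = (n - 1 - s', n - 1 - t')%N; last by rewrite !inv.
  apply: u; split=> /=; [exact: sym|exact: sym|].
  by have := A_lt _ As'; have := A_lt _ At'; lia.
- move=> s' t' As' At' e; apply: (h _ _ (sym _ As') (sym _ At')).
  have := A_lt _ As'; have := A_lt _ At'; lia.
Qed.

(** The reflection [rev_ord] is a bijection between the intervals counted by
    diagonal entries, and between those counted by off-diagonal entries. *)
Lemma adjacency_mx_sym (M := adjacency_mx R n A) :
  (M 0%R 0%R + M 0%R 1%R = M 1%R 0%R + M 1%R 1%R)%N.
Proof.
have eqP2 (P Q : Prop) : (P <-> Q) -> `[< P >] = `[< Q >] by exact: asbool_equiv_eq.
rewrite /M !mxE /= addnC; congr (_ + _)%N; rewrite -(card_preimset _ (@rev_ord_inj _));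
  apply: eq_card => l; rewrite !inE /=; congr (_ && _); have := ltn_ord l; try lia.
  by move=> hl; apply: eqP2; rewrite type_LR_sym.
move=> hl; apply: eqP2; rewrite type_LR_sym; last lia.
have -> : (2 * n - (2 * n - l.+1).+1 = l)%N by lia.
by [].
Qed.

End Grid.

(** * The set of uniqueness *)

Section UniquenessSet.
Variables (R : realType) (n k : nat).
Hypothesis hn : (6 * 3 ^ k < n)%N.

Let A := digit_set n k.
Let m_gt0 : (0 < 3 ^ k)%N. Proof. by rewrite expn_gt0. Qed.
Let n2 : (2 <= n)%N. Proof. by have := m_gt0; lia. Qed.
Let n0 : 0 < n%:R :> R. Proof. by rewrite ltr0n; lia. Qed.

Let A_lt (x : nat) : A x -> (x < n)%N. Proof. exact: digit_set_lt. Qed.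

Lemma cantor_digitsP (x : R) :
  cantor_digits n A x <-> exists2 a : nat -> nat, (forall i, A (a i)) & expansion_value R n a = x.
Proof.
split=> -[a ha hx]; exists a => //; first exact: expansion_valueE.
by rewrite -hx; apply: expansion_cvg => // i; exact: digit_set_lt (ha i).
Qed.

Lemma cantor_digits_itv (x : R) : cantor_digits n A x -> 0 <= x <= 1.
Proof.
move=> /cantor_digitsP[a ha <-].
have al i : (a i < n)%N := A_lt _ (ha i).
by rewrite expansion_value_ge0// expansion_value_le1.
Qed.

Lemma digit_set_good : good R n A.
Proof.
split; [exact: n2|exact: digit_set0|exact: digit_set_max|exact: A_lt|].
apply/seteqP; split=> [_ [x hx [y hy <-]]|z]; rewrite /= in_itv /=.
  have := cantor_digits_itv _ hx; have := cantor_digits_itv _ hy.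
  by move=> /andP[? ?] /andP[? ?]; apply/andP; split; lra.
move=> hz.
have [y hy|c [hc cz]] := @expansion_exists R n n2
    (fun m => exists s t, [/\ A s, A t & m = (s + t)%N]) 2 z _ hz.
  have [l [hl l0 l2]] : exists l : nat, [/\ (l < 2 * n)%N, l%:R <= n%:R * y & n%:R * y <= l.+1%:R].
    (* The grid interval of y has index trunc (n y), except at the end y = 2. *)
    have [y2|ylt] := eqVneq y 2.
      exists (2 * n).-1; rewrite prednK; last lia.
      by split; [lia| |]; rewrite y2 -natrM ler_nat; lia.
    have ny0 : 0 <= n%:R * y by case/andP: hy => h _; rewrite mulr_ge0// ltW.
    have /andP[t1 t2] := truncn_itv ny0.
    exists (Num.trunc (n%:R * y)); split=> //; last exact: ltW.
    rewrite truncn_lt_nat// natrM mulrC ltr_pM2r// lt_neqAle ylt; by case/andP: hy.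
  have [s [t [hs ht st]]] := digit_set_cover _ _ hn _ hl.
  exists (s + t)%N; split; first by exists s, t.
  move: l0 l2; case: st => ->; rewrite -?(natr1 _ (s + t)) -?(natr1 _ (s + t).+1) => l0 l2;
    apply/andP; split; lra.
have /choice[st hst] : forall i, exists st : nat * nat, [/\ A st.1, A st.2 & c i = (st.1 + st.2)%N].
  by move=> i; have [s [t h]] := hc i; exists (s, t).
have al i : ((fst \o st) i < n)%N by case: (hst i) => /A_lt.
have bl i : ((snd \o st) i < n)%N by case: (hst i) => _ /A_lt.
have cE i : c i = ((fst \o st) i + (snd \o st) i)%N by case: (hst i).
exists (expansion_value R n (fst \o st)).
  by apply/cantor_digitsP; exists (fst \o st) => // i; case: (hst i).
exists (expansion_value R n (snd \o st)).
  by apply/cantor_digitsP; exists (snd \o st) => // i; case: (hst i).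
have h := expansion_value_add R _ n2 _ _ _ al bl cE.
by rewrite -(expansion_valueE _ _ _ _ cz) (expansion_valueE _ _ _ _ h).
Qed.

Lemma digit_set_very_good : very_good R n A.
Proof.
split; [exact: digit_set_good|exact: digit_set1|exact: digit_set_n2|left].
apply: adjacency_mx_sym; [by lia|exact: A_lt|].
by move=> x; exact: digit_set_sym.
Qed.

(** Uniqueness applied to the swapped pair gives [x = y]; applied to the pair
    obtained by splitting one doubled digit differently, it shows that every
    digit is rigid. *)
Lemma uniqueness_set_sub :
  uniqueness_set n A `<=`
    [set 2 * expansion_value R n a | a in [set a | forall i, a i \in rigid_digits n k]].
Proof.
move=> z [_ [[x y] [[/= hx hy zxy] u]]].
have xy : x = y.
  by have [] : (x, y) = (y, x) by apply: u; split=> //=; rewrite addrC.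
have /cantor_digitsP[a ha ax] := hx; have al i : (a i < n)%N := A_lt _ (ha i).
exists a => [i|]; last by rewrite ax zxy -xy; ring.
apply: (rigid_digitsP n k hn _ (ha i)) => s t hs ht st.
pose b j := if j == i then s else a j; pose c j := if j == i then t else a j.
have hb j : A (b j) by rewrite /b; case: ifP.
have hc j : A (c j) by rewrite /c; case: ifP.
have bl j : (b j < n)%N := A_lt _ (hb j).
have cl j : (c j < n)%N := A_lt _ (hc j).
have bc j : (a j + a j = b j + c j)%N.
  by rewrite /b /c; case: eqP => [->|//]; lia.
have h1 := expansion_value_add R _ n2 _ _ _ al al (fun j => erefl).
have h2 := expansion_value_add R _ n2 _ _ _ bl cl bc.
have e : z = expansion_value R n b + expansion_value R n c.
  by rewrite -(expansion_valueE _ _ _ _ h2) (expansion_valueE _ _ _ _ h1) ax zxy -xy.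
have [xb _] : (x, y) = (expansion_value R n b, expansion_value R n c).
  by apply: u; split=> //=; apply/cantor_digitsP; [exists b|exists c].
have := expansion_value_inj_at R n n2 i b a bl al _ _.
rewrite /b eqxx; apply; last by rewrite -xb ax.
by move=> j /negbTE ->.
Qed.

Lemma hausdorff_dim_le (s : R) : 0 <= s -> (2 ^ k.+1)%N%:R < n%:R `^ s ->
  (hausdorff_dim (uniqueness_set n A : set R) <= s%:E)%E.
Proof.
move=> s0 hs; apply: ge_ereal_inf; exists s%:E => //; exists s => //; split=> //.
apply: (hausdorff_measure_expansions_eq0 R n (rigid_digits n k)) uniqueness_set_sub => //.
  move=> d; rewrite mem_cat => /orP[/ternary_digits_lt|/mapP[d' _ ->]]; last by lia.
  by have := m_gt0; lia.
by rewrite size_cat size_map size_map size_iota addnn -mul2n -expnS.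
Qed.

(** Odd indices have lowest base-3 digit 2, so these digits are nonzero: an
    expansion made of them is never an endpoint of a cylinder. *)
Let e (i : nat) : nat := ternary_code k (i.*2).+1.

Hypothesis k2 : (2 <= k)%N.
Let N := (2 ^ k.-1)%N.

Lemma odd_code_bound (i : nat) : (i < N)%N -> ((i.*2).+1 < 2 ^ k)%N.
Proof. by rewrite /N -{2}(prednK (ltnW k2)) expnS; lia. Qed.

Lemma odd_code_in (i : nat) : (i < N)%N -> e i \in ternary_digits k.
Proof. by move=> /odd_code_bound; exact: ternary_code_in. Qed.

Lemma odd_code_gt0 (i : nat) : (0 < e i)%N.
Proof. by rewrite /e -(prednK (ltnW k2)) /= odd_double /=; lia. Qed.

(** The tail of [e \o a] has a value strictly between 0 and 1, so
    [b 0 + c 0] is within distance less than 2 of [2 * e (a 0)], and the only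
    sum of two digits in that range is [e (a 0) + e (a 0)]. *)
Lemma odd_code_rigid_head (a b c : nat -> nat) :
  (forall i, (a i < N)%N) -> (forall i, A (b i)) -> (forall i, A (c i)) ->
  2 * expansion_value R n (e \o a) = expansion_value R n b + expansion_value R n c ->
  [/\ b 0%N = e (a 0%N), c 0%N = e (a 0%N) &
   2 * expansion_value R n (e \o tail a) =
     expansion_value R n (tail b) + expansion_value R n (tail c)].
Proof.
move=> ha hb hc.
have el i : ((e \o a) i < n)%N.
  by apply: A_lt; apply: digit_set_ternary; exact: odd_code_in.
have bl i : (b i < n)%N := A_lt _ (hb i).
have cl i : (c i < n)%N := A_lt _ (hc i).
rewrite (expansion_value_cons R _ n2 _ el) (expansion_value_cons R _ n2 _ bl).
rewrite (expansion_value_cons R _ n2 _ cl) -mulrDl mulrA => /(divIf (lt0r_neq0 n0)).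
rewrite -[tail (e \o a)]/(e \o tail a) /= => E.
have e1 : 0 < expansion_value R n (e \o tail a) < 1.
  rewrite (expansion_value_cons R _ n2 _ (fun i => el i.+1)).
  have t0 := expansion_value_ge0 R _ n2 _ (fun i => el i.+2).
  have t1 := expansion_value_le1 R _ n2 _ (fun i => el i.+2).
  have d0 : 1 <= (e (a 1%N))%:R :> R by rewrite ler1n; exact: odd_code_gt0.
  have d1 : (e (a 1%N))%:R + 2 <= n%:R :> R.
    rewrite -natrD ler_nat.
    by have := ternary_digits_lt _ _ (odd_code_in _ (ha 1%N)); have := m_gt0; lia.
  rewrite divr_gt0 ?ltr_pdivrMr//; last by move: t0 d0; rewrite /tail /=; lra.
  by move: t1 d1; rewrite /tail /= mul1r; lra.
have b0 := expansion_value_ge0 R _ n2 _ (fun i => bl i.+1).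
have b1 := expansion_value_le1 R _ n2 _ (fun i => bl i.+1).
have c0 := expansion_value_ge0 R _ n2 _ (fun i => cl i.+1).
have c1 := expansion_value_le1 R _ n2 _ (fun i => cl i.+1).
move/andP: e1 => [e0 e1].
have [hb0 hc0] : b 0%N = e (a 0%N) /\ c 0%N = e (a 0%N).
  apply: (digit_set_uniq_sum n k hn _ _ _ (odd_code_in _ (ha 0%N)) (hb 0%N) (hc 0%N)).
    suff : (2 * e (a 0%N))%N%:R < (b 0%N + c 0%N + 2)%N%:R :> R by rewrite ltr_nat; lia.
    by rewrite [(2 * _)%N%:R]natrM !natrD; lra.
  suff : (b 0%N + c 0%N)%N%:R < (2 * e (a 0%N) + 2)%N%:R :> R by rewrite ltr_nat; lia.
  by rewrite natrD [X in _ < X]natrD [(2 * _)%N%:R]natrM; lra.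
by split=> //; move: E; rewrite hb0 hc0; lra.
Qed.

Lemma odd_code_rigid (a b c : nat -> nat) (j : nat) :
  (forall i, (a i < N)%N) -> (forall i, A (b i)) -> (forall i, A (c i)) ->
  2 * expansion_value R n (e \o a) = expansion_value R n b + expansion_value R n c ->
  b j = e (a j) /\ c j = e (a j).
Proof.
elim: j a b c => [|j IH] a b c ha hb hc /(odd_code_rigid_head a b c ha hb hc)[//].
by move=> _ _; apply: IH => i; [exact: ha|exact: hb|exact: hc].
Qed.

Lemma sub_uniqueness_set :
  [set 2 * expansion_value R n (e \o a) | a in [set a | forall i, (a i < N)%N]] `<=`
    uniqueness_set n A.
Proof.
move=> _ [a ha <-]; set x := expansion_value R n (e \o a).
have hx : cantor_digits n A x.
  apply/cantor_digitsP; exists (e \o a) => // i.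
  by apply: digit_set_ternary; exact: odd_code_in.
split; first by exists x => //; exists x => //; ring.
exists (x, x); split=> [|[x' y'] [/= /cantor_digitsP[b hb <-] /cantor_digitsP[c hc <-] E]].
  by split=> //=; ring.
have h j := odd_code_rigid a b c j ha hb hc E.
have -> : b = e \o a by apply/funext => j; case: (h j).
by have -> : c = e \o a by apply/funext => j; case: (h j).
Qed.

Lemma hausdorff_dim_ge (s : R) : 0 <= s -> n%:R `^ s <= N%:R ->
  (s%:E <= hausdorff_dim (uniqueness_set n A : set R))%E.
Proof.
move=> s0 hs; apply/ereal_infP => _ [t [t0 ht] <-]; rewrite lee_fin leNgt.
apply/negP => ts; have nt : n%:R `^ t <= N%:R.
  by apply: le_trans hs; apply: ler_powR; [rewrite ler1n; lia|exact: ltW].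
apply: (hausdorff_measure_expansions_neq0 R n N e n2 _ _ _ _ t t0 nt sub_uniqueness_set ht).
- by rewrite /N; case: (k) k2 => [//|[//|k']] _; rewrite /= expnS leq_pmulr// expn_gt0.
- by move=> i hi; apply: A_lt; apply: digit_set_ternary; exact: odd_code_in.
- move=> i j hij; apply: ternary_code_gap.
  by have := odd_code_bound j; lia.
Qed.

End UniquenessSet.

(** * The limit *)

Theorem corollary4p5 (R : realType) :
  exists (N : nat) (A : nat -> set nat),
    (forall n : nat, (N <= n)%N -> very_good R n (A n)) /\
    hausdorff_dim (uniqueness_set n (A n) : set R) @[n --> \oo]
      --> (ln 2 / ln 3 : R)%:E.
Proof.
(* The shift by 2 leaves room for 6 * 3 ^ K n < n, and makes the upper bound
   2 ^ (K n).+1 < n ^ s valid for every s > ln 2 / ln 3. *)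
pose K n := (trunc_log 3 n - 2)%N.
have Kn n : (81 <= n)%N -> [/\ (2 <= K n)%N, (3 ^ (K n).+2 <= n)%N & (n < 3 ^ (K n).+3)%N].
  move=> hn; have /andP[h1 h2] := @trunc_log_bounds 3 n isT (leq_trans (isT : (0 < 81)%N) hn).
  have h3 : (4 <= trunc_log 3 n)%N by apply: trunc_log_max.
  by rewrite /K (_ : (trunc_log 3 n - 2).+2 = trunc_log 3 n)%N; [split=> //; lia|lia].
have K6 n : (81 <= n)%N -> (6 * 3 ^ K n < n)%N.
  by move=> /Kn[_ + _]; rewrite !expnS; have : (0 < 3 ^ K n)%N; [rewrite expn_gt0|lia].
have l2 : 0 < ln 2 :> R by rewrite ln_gt0// ltr1n.
have l3 : 0 < ln 3 :> R by rewrite ln_gt0// ltr1n.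
exists 81%N, (fun n => digit_set n (K n)); split=> [n /K6|]; first exact: digit_set_very_good.
(* This is (K n - 1) ln 2 / ((K n + 3) ln 3), written so that its limit shows. *)
pose lower (n : nat) : R := (1 - 4 / (trunc_log 3 n).+1%:R) * (ln 2 / ln 3).
have lower_cvg : lower n @[n --> \oo] --> ln 2 / ln 3.
  rewrite -[X in _ --> X]mul1r; apply: cvgM; last exact: cvg_cst.
  rewrite -[X in _ --> X]subr0; apply: cvgB; first exact: cvg_cst.
  rewrite -[X in _ --> X](mulr0 4); apply: cvgM; first exact: cvg_cst.
  apply: (cvg_comp (trunc_log 3) (fun m : nat => m.+1%:R^-1)) _ (@cvg_harmonic R).
  move=> S [m _ hm]; exists (3 ^ m)%N => // n /= hn; apply: hm => /=.
  by apply: trunc_log_max.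
apply: (@squeeze_cvge _ _ _ _ (fun n => (lower n)%:E) _ (fun=> (ln 2 / ln 3)%:E)); last exact: cvg_cst; last first.
  by apply/cvg_EFin; [near=> n|exact: lower_cvg].
near=> n; have n81 : (81 <= n)%N by near: n; exists 81%N.
have [k2 h1 h2] := Kn n n81.
have n_gt0 : 0 < n%:R :> R by rewrite ltr0n; lia.
have ln_n : 0 < ln (n%:R : R) by rewrite ln_gt0// ltr1n; lia.
have h1' : (K n).+2%:R * ln 3 <= ln (n%:R : R).
  rewrite mulr_natl -lnXn// -natrX ler_ln ?posrE ?ltr0n ?expn_gt0//; [by rewrite ler_nat|lia].
have h2' : ln (n%:R : R) <= (K n).+3%:R * ln 3.
  rewrite mulr_natl -lnXn// -natrX ler_ln ?posrE ?ltr0n ?expn_gt0//; [by rewrite ler_nat ltnW|lia].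
have powE (s : R) : n%:R `^ s = expR (s * ln n%:R) by rewrite /powR gt_eqF.
have two (m : nat) : (2 ^ m)%N%:R = expR (m%:R * ln 2) :> R.
  by rewrite natrX -powR_mulrn// /powR gt_eqF.
apply/andP; split.
  have kE : (trunc_log 3 n).+1 = (K n).+3 by move: k2; rewrite /K; lia.
  have lE : lower n = ((K n).-1%:R * ln 2) / ((K n).+3%:R * ln 3).
    rewrite /lower kE -[(K n).+3]addn3 -subn1 natrB; last by lia.
    rewrite natrD; field.
    by rewrite gt_eqF//= -natrD pnatr_eq0 addn3.
  have hlow0 : 0 <= lower n.
    by rewrite lE divr_ge0// mulr_ge0// ltW.
  apply: hausdorff_dim_ge => //; first exact: K6.
  rewrite powE two ler_expR lE -mulrA ler_piMr//; first by rewrite mulr_ge0// ltW.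
  by rewrite mulrC ler_pdivrMr ?mul1r// mulr_gt0.
apply/lee_addgt0Pr => eps eps0; rewrite -EFinD; apply: hausdorff_dim_le.
- exact: K6.
- by rewrite addr_ge0 ?(ltW eps0)// divr_ge0 ?(ltW l2) ?(ltW l3).
- rewrite powE two ltr_expR.
  apply: (@lt_le_trans _ _ ((K n).+2%:R * ln 2)); first by rewrite ltr_pM2r// ltr_nat.
  apply: (@le_trans _ _ (ln 2 / ln 3 * ln n%:R)); last by rewrite ler_pM2r// lerDl ltW.
  by rewrite mulrC -mulrA ler_pM2l// [_^-1 * _]mulrC ler_pdivlMr.
Unshelve. all: by end_near.
Qed.
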